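(* Fix a real number $\alpha>0$. For each integer $k\geq1$ let $\sigma_k$ be the measure on $\mathbb{R}^k\subset\mathbb{C}^k$ with density $$d\sigma_k(a)=\frac{\Gamma(\frac{k}{2}+\alpha)}{\Gamma(\alpha)\,\pi^{k/2}}\,(1+|a|^2)^{-\frac{k}{2}-\alpha}\,d\lambda_k(a),\qquad a=(a_1,\ldots,a_k)\in\mathbb{R}^k,$$ where $\Gamma$ is the Euler Gamma function. Then $\sigma_k$ is a probability measure. Moreover, for every integer $k\geq1$, every real $\nu\geq1$, and every $u\in\mathbb{C}^k$ with $|u|=1$, $$\int_{\mathbb{R}^k}\big|\log|\langle a,u\rangle|\big|^\nu\,d\sigma_k(a)\leq\Gamma_{\alpha,\nu},$$ where $\Gamma_{\alpha,\nu}>0$ is a (finite) constant depending only on $\alpha$ and $\nu$ (in particular, not on $k$ or $u$).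
   Context: For $a,v\in\mathbb{C}^k$ with $a=(a_1,\ldots,a_k)$, $v=(v_1,\ldots,v_k)$, the (bilinear) pairing is $\langle a,v\rangle=\sum_{j=1}^k a_jv_j$ (no complex conjugation), and $|v|^2=\langle v,\overline v\rangle=\sum_{j=1}^k|v_j|^2$. $\lambda_k$ is the Lebesgue measure on $\mathbb{R}^k\subset\mathbb{C}^k$. The logarithm is the natural logarithm. *)

(* Defs.v *)
From HB Require Import structures.
From mathcomp Require Import all_boot all_order all_algebra.
From mathcomp Require Import complex.
From mathcomp Require Import all_classical all_reals all_analysis.
From mathcomp Require Import measurable_realfun measurable_fun_approximation.

Set Implicit Arguments.
Unset Strict Implicit.
Unset Printing Implicit Defensive.
Import Order.TTheory GRing.Theory Num.Theory.
Import numFieldNormedType.Exports.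

Local Open Scope classical_set_scope.
Local Open Scope ring_scope.

(* R^k is the type k.-tuple R with its Borel sigma-algebra; C^k is
   k.-tuple R[i]. *)

Section lebesgue_tuple.
Variable R : realType.

Definition cons_pair k (p : R * k.-tuple R) : k.+1.-tuple R :=
  [tuple of p.1 :: p.2].

Lemma measurable_cons_pair k : measurable_fun [set: _] (@cons_pair k).
Proof. exact: (measurable_cons measurable_fst measurable_snd). Qed.

Section lebesgue_cons.
Variables (k : nat) (m : {measure set (k.-tuple R) -> \bar R}).

(* The product \x^ requires sigma-finiteness of its left factor only, so the
   recursion below can stay in {measure set _ -> \bar R}. *)
Definition lebesgue_cons : set (k.+1.-tuple R) -> \bar R :=
  pushforward (@lebesgue_measure R \x^ m)%E (@cons_pair k).

Let lebesgue_cons_measure : {measure set (k.+1.-tuple R) -> \bar R} :=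
  @measure_function_pushforward__canonical__measure_function_Measure
    _ _ _ _ _ (@lebesgue_measure R \x^ m)%E _ (@measurable_cons_pair k).

HB.instance Definition _ := Measure.copy lebesgue_cons lebesgue_cons_measure.

End lebesgue_cons.

Fixpoint lebesgue_tuple k : {measure set (k.-tuple R) -> \bar R} :=
  match k with
  | 0%N => \d_([tuple] : 0.-tuple R)
  | k'.+1 => lebesgue_cons (lebesgue_tuple k')
  end.

Local Open Scope ereal_scope.

(* Together with sigma-finiteness, this determines lebesgue_tuple k. *)
Lemma lebesgue_tuple_box k (A : 'I_k -> set R) :
  (forall i, measurable (A i)) ->
  lebesgue_tuple k [set a | forall i, A i (tnth a i)] =
  \prod_(i < k) lebesgue_measure (A i).
Proof.
elim: k A => [|k IH] A mA.
  rewrite big_ord0 /= diracE mem_set//= => -[]//.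
have mB : measurable [set a : k.-tuple R | forall i, A (lift ord0 i) (tnth a i)].
  rewrite [X in measurable X](_ : _ = \bigcap_(i in [set: 'I_k])
      ((@tnth _ _)^~ i @^-1` A (lift ord0 i))).
    apply: fin_bigcap_measurable => // i _.
    by rewrite -[X in measurable X]setTI; exact: measurable_tnth.
  by apply/seteqP; split => [a h i _|a h i]; [exact: h|exact: (h i I)].
rewrite big_ord_recl -IH => [|i]; last exact: mA.
rewrite /= /lebesgue_cons /pushforward -product_measure2E//; last exact: mA.
congr (_ _); apply/seteqP; split => [[x a] /= h|[x a] /= [h0 h] i].
  by split => [|i]; [have := h ord0|have := h (lift ord0 i); rewrite tnthS].
by case: (unliftP ord0 i) => [j ->|->]; rewrite ?tnthS ?tnth0.
Qed.

End lebesgue_tuple.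

Section pairing.
Variables (R : rcfType) (k : nat).

Definition pairing (a v : k.-tuple R[i]) : R[i] :=
  \sum_(j < k) tnth a j * tnth v j.

Definition cvnorm (v : k.-tuple R[i]) : R :=
  Num.sqrt (\sum_(j < k) Normc.normc (tnth v j) ^+ 2).

Definition real_tuple (a : k.-tuple R) : k.-tuple R[i] :=
  map_tuple (real_complex R) a.

Lemma cvnorm_pairing (v : k.-tuple R[i]) :
  (cvnorm v ^+ 2)%:C%C = pairing v (map_tuple conjc v).
Proof.
rewrite sqr_sqrtr; last by apply: sumr_ge0 => j _; exact: sqr_ge0.
rewrite rmorph_sum/=; apply: eq_bigr => j _.
by rewrite tnth_map -sqr_normc rmorphXn.
Qed.

Lemma cvnorm_real (a : k.-tuple R) :
  cvnorm (real_tuple a) ^+ 2 = \sum_(j < k) tnth a j ^+ 2.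
Proof.
rewrite sqr_sqrtr; last by apply: sumr_ge0 => j _; exact: sqr_ge0.
apply: eq_bigr => j _.
by rewrite tnth_map /= expr0n /= addr0 sqr_sqrtr ?sqr_ge0.
Qed.

End pairing.

Section sigma.
Variable R : realType.

Definition Gamma (x : R) : R :=
  \int[lebesgue_measure]_(t in `]0, +oo[) (t `^ (x - 1) * expR (- t)).

Lemma Gamma_ge0 x : 0 <= Gamma x.
Proof.
apply: Rintegral_ge0 => t _.
by rewrite mulr_ge0 ?powR_ge0 ?expR_ge0.
Qed.

Definition sigma_density k (alpha : R) (a : k.-tuple R) : R :=
  Gamma (k%:R / 2 + alpha) / (Gamma alpha * pi `^ (k%:R / 2)) *
  (1 + cvnorm (real_tuple a) ^+ 2) `^ (- (k%:R / 2) - alpha).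

Lemma sigma_density_ge0 k alpha (a : k.-tuple R) : 0 <= sigma_density alpha a.
Proof.
by rewrite mulr_ge0 ?powR_ge0// divr_ge0 ?mulr_ge0 ?Gamma_ge0 ?powR_ge0.
Qed.

Lemma measurable_sigma_density k alpha :
  measurable_fun [set: k.-tuple R] (sigma_density alpha).
Proof.
apply: measurable_funM => //.
apply: (measurableT_comp (measurable_powR _)) => //.
under eq_fun do rewrite cvnorm_real.
apply: measurable_funD => //.
apply: measurable_sum => j; apply: measurable_funX; exact: measurable_tnth.
Qed.

Definition sigma k (alpha : R) : set (k.-tuple R) -> \bar R :=
  fun A => (\int[lebesgue_tuple R k]_(a in A) (sigma_density alpha a)%:E)%E.

Section measure.
Variables (k : nat) (alpha : R).

Let sigma0 : sigma alpha (set0 : set (k.-tuple R)) = 0%E.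
Proof. exact: integral_set0. Qed.

Let sigma_ge0 (A : set (k.-tuple R)) : (0 <= sigma alpha A)%E.
Proof. by apply: integral_ge0 => a _; rewrite lee_fin sigma_density_ge0. Qed.

Let sigma_sigma_additive : semi_sigma_additive (@sigma k alpha).
Proof.
move=> F mF tF mUF; rewrite /sigma ge0_integral_bigcup//=; last first.
- by move=> a _; rewrite lee_fin sigma_density_ge0.
- apply/measurable_EFinP/measurable_funTS; exact: measurable_sigma_density.
apply: is_cvg_ereal_nneg_natsum_cond => n _ _.
by apply: integral_ge0 => a _; rewrite lee_fin sigma_density_ge0.
Qed.

HB.instance Definition _ := isMeasure.Build _ _ _ (@sigma k alpha)
  sigma0 sigma_ge0 sigma_sigma_additive.

End measure.
End sigma.

(* Main.v *)
(* With s = k/2 + alpha, the identity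
     Gamma(s) c^(-s) = \int_0^oo t^(s-1) e^(-ct) dt,   c = 1 + |a|^2,
   exhibits sigma_k as a mixture over t > 0, with weight t^(alpha-1) e^(-t) /
   Gamma(alpha), of the Gaussian laws of density (t/pi)^(k/2) e^(-t|a|^2).
   Total mass 1 follows at once, and moments reduce to fixed t.  There, the
   closed form of \int e^(-t|a|^2 - l(<a,x>+c)^2) da, whose k-dependence is only
   through |x|^2, is obtained by integrating one coordinate at a time, and it
   plays two roles.  Write u = x + iy; one of |x|^2, |y|^2, say |x|^2, is at
   least 1/2.
   - For |<a,u>| <= 1, |log|<a,u>||^nu is at most a constant times
     \sum_n 2^n e^(-16^n <a,x>^2): this is l = 16^n, and the integral is
     O(t^(1/2)).
   - For |<a,u>| >= 1, |log|<a,u>||^nu is at most a constant times |<a,u>|^(2p)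
     <= 2 t^(-p) (e^(t<a,x>^2/2) + e^(t<a,y>^2/2)), with p = alpha/(alpha+1):
     this is l = -t/2, and the integral is O(t^(-p)).
   Since p < alpha, both powers of t are integrable against the weight. *)
From HB Require Import structures.
Require Import Defs.
From mathcomp Require Import all_boot all_order all_algebra.
From mathcomp Require Import complex.
From mathcomp Require Import all_classical all_reals all_analysis.
From mathcomp Require Import measurable_realfun measurable_fun_approximation.
From mathcomp Require Import ring lra.

Set Implicit Arguments.
Unset Strict Implicit.
Unset Printing Implicit Defensive.
Import Order.TTheory GRing.Theory Num.Theory.
Import numFieldNormedType.Exports.
Local Open Scope classical_set_scope.
Local Open Scope ring_scope.

(** * Integration *)

(** The integral of a nonnegative function is a supremum over the simple functions below it, and
    those below [f] are below [g]. The argument is purely order-theoretic, which suits integrands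
    that are themselves integrals or series. *)
Lemma ge0_le_integralT d (T : measurableType d) (R : realType)
    (m : {measure set T -> \bar R}) (f g : T -> \bar R) :
  (forall x, 0 <= f x)%E -> (forall x, f x <= g x)%E ->
  (\int[m]_x f x <= \int[m]_x g x)%E.
Proof.
move=> f0 fg; rewrite !ge0_integralTE//; last first.
  by move=> x; rewrite (le_trans (f0 x)).
apply: le_ereal_sup => _ [h hf <-]; exists h => //= x.
exact: le_trans (hf x) (fg x).
Qed.

(** * Integration against a measure with a density *)

Section change_of_density.
Context d (T : measurableType d) (R : realType).
Variables (m m' : {measure set T -> \bar R}) (h : T -> R).
Hypotheses (mh : measurable_fun [set: T] h) (h0 : forall x, 0 <= h x).
Hypothesis m'E : forall A, measurable A -> m' A = (\int[m]_(x in A) (h x)%:E)%E.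
Local Open Scope ereal_scope.
Import HBNNSimple.

Let integral_density_nnsfun (g : {nnsfun T >-> R}) :
  \int[m']_x (g x)%:E = \int[m]_x ((g x)%:E * (h x)%:E).
Proof.
under eq_integral do rewrite fimfunE -fsumEFin//.
rewrite ge0_integral_fsum//; last 2 first.
- by move=> y; exact/measurable_EFinP/measurable_funM.
- by move=> y x _; rewrite nnfun_muleindic_ge0.
under [RHS]eq_integral.
  move=> x _; rewrite fimfunE -fsumEFin// ge0_mule_fsuml; last first.
    by move=> r; rewrite EFinM nnfun_muleindic_ge0.
  over.
rewrite [RHS]ge0_integral_fsum//; last 2 first.
- move=> y; apply: emeasurable_funM; last exact/measurable_EFinP.
  exact/measurable_EFinP/measurable_funM.
- move=> r x _; apply: mule_ge0; last by rewrite lee_fin.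
  by rewrite EFinM nnfun_muleindic_ge0.
apply: eq_fsbigr => r rg; rewrite integralZl_indic_nnsfun// integral_indic//= setIT.
(* Pulling out the scalar [r] requires [0 <= r]; a negative [r] has empty preimage under [g], so
   both sides vanish. *)
have [r0|r0] := ltP r 0%R.
  rewrite preimage_nnfun0// measure0 mule0 integral0_eq// => x _.
  by rewrite indicE in_set0 mulr0 mul0e.
under eq_integral do rewrite EFinM -muleA.
rewrite ge0_integralZl//; last 2 first.
- apply: emeasurable_funM; last exact/measurable_EFinP.
  exact/measurable_EFinP/measurable_indic.
- by move=> x _; rewrite mule_ge0// lee_fin ?h0.
congr (_ * _); rewrite m'E// [LHS]integral_mkcond; apply: eq_integral => x _.
by rewrite patchE indicE; case: ifPn => _; rewrite ?mul1e ?mul0e.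
Qed.

(** Simple functions reduce to the hypothesis on sets; monotone convergence along an increasing
    simple approximation of [f] does the rest. *)
Lemma ge0_integral_density (f : T -> \bar R) :
  measurable_fun [set: T] f -> (forall x, 0 <= f x) ->
  \int[m']_x f x = \int[m]_x (f x * (h x)%:E).
Proof.
move=> mf f0; pose g := nnsfun_approx measurableT mf.
have gf x : EFin \o g ^~ x @ \oo --> f x.
  by apply: cvg_nnsfun_approx => // y _.
have gnd x : {homo (fun n => (g n x)%:E) : a b / (a <= b)%N >-> a <= b}.
  by move=> a b ab; rewrite lee_fin; exact/lefP/nd_nnsfun_approx.
transitivity (limn (fun n => \int[m']_x (g n x)%:E)).
  rewrite -monotone_convergence//.
  - by apply: eq_integral => x _; apply/esym/cvg_lim => //; exact: gf.
  - by move=> n; exact/measurable_EFinP.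
  - by move=> n x _; rewrite lee_fin.
under eq_fun do rewrite integral_density_nnsfun.
rewrite -monotone_convergence//.
- apply: eq_integral => x _; apply/cvg_lim => //.
  by apply: cvgeZr => //; exact: gf.
- by move=> n; apply: emeasurable_funM; exact/measurable_EFinP.
- by move=> n x _; rewrite mule_ge0// lee_fin ?h0.
- by move=> x _ a b ab; rewrite lee_wpmul2r ?lee_fin ?h0//; exact: gnd.
Qed.

End change_of_density.

(** * Scaling of Lebesgue measure on the line *)

Section scaling.
Variables (R : realType).
Local Open Scope ereal_scope.
Local Notation mu := (@lebesgue_measure R).

Let scale (c : R) (x : measurableTypeR R) : measurableTypeR R := (c * x)%R.

Let measurable_scale c : measurable_fun [set: measurableTypeR R] (scale c).
Proof. exact: mulrl_measurable. Qed.

Lemma ge0_integral_lebesgue_scale (c : R) (f : R -> \bar R) : (0 < c)%R ->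
  measurable_fun [set: R] f -> (forall x, 0 <= f x) ->
  \int[mu]_x f x = c%:E * \int[mu]_x f (c * x)%R.
Proof.
move=> c0 mf f0.
pose pm : {measure set (measurableTypeR R) -> \bar R} :=
  @measure_function_pushforward__canonical__measure_function_Measure
    _ _ _ _ _ mu _ (@measurable_scale c).
pose m' : {measure set (measurableTypeR R) -> \bar R} := mscale (NngNum (ltW c0)) pm.
transitivity (\int[m']_x f x).
  (* The pushforward under x -> cx, multiplied by c, gives ]a, b] the mass c(b/c - a/c) = b - a, so
     it is Lebesgue measure. *)
  apply: eq_measure_integral => A mA _; apply: lebesgue_measure_unique => //.
  move=> _ [[a b] _ <-] /=; rewrite /mscale/= /pushforward.
  rewrite (_ : scale c @^-1` _ = [set` `]c^-1 * a, c^-1 * b]%R]); last first.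
    by apply/seteqP; split => x /=; rewrite !in_itv/= ltr_pdivrMl// ler_pdivlMl.
  rewrite !lebesgue_measure_itv/= !lte_fin ltr_pM2l ?invr_gt0//.
  case: ifPn => _; last by rewrite mule0.
  by rewrite -!EFinD -EFinM -mulrBr mulrA mulfV ?mul1r ?gt_eqF.
rewrite ge0_integral_mscale//=; congr (_ * _).
by rewrite (ge0_integral_pushforward (@measurable_scale c)).
Qed.

End scaling.

(** * Sigma-finiteness and Tonelli on tuples *)

Section lebesgue_tuple_sigma_finite.
Variable R : realType.
Local Open Scope ereal_scope.

(* A copy of [lebesgue_tuple] with its own head constant, on which the
   sigma-finite structure required by Fubini-Tonelli can be declared. *)
Definition tlebesgue k : set (k.-tuple R) -> \bar R := lebesgue_tuple R k.
HB.instance Definition _ k := Measure.copy (@tlebesgue k) (lebesgue_tuple R k).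

Lemma sigma_finite_tlebesgue k : sigma_finite setT (@tlebesgue k).
Proof.
exists (fun n => [set a : k.-tuple R | forall i : 'I_k,
    [set` `[- n%:R, n%:R]%R] (tnth a i)]).
  apply/seteqP; split => // a _.
  (* The cubes [-n, n]^k exhaust the space: a bound on the sum of the |a_i| bounds each of them. *)
  have [n hn] : exists n : nat, (\sum_(i < k) `|tnth a i| <= n%:R)%R.
    by eexists; apply/ltW/archi_boundP/sumr_ge0.
  exists n => // i /=; rewrite in_itv/= -ler_norml (le_trans _ hn)//.
  by rewrite (bigD1 i)//= lerDl sumr_ge0.
move=> n; split.
  rewrite [X in measurable X](_ : _ = \bigcap_(i in [set: 'I_k])
      ((@tnth _ _)^~ i @^-1` [set` `[- n%:R, n%:R]%R])).
    apply: fin_bigcap_measurable => // i _.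
    by rewrite -[X in measurable X]setTI; exact: measurable_tnth.
  by apply/seteqP; split => [a h i _|a h i]; [exact: h|exact: (h i I)].
rewrite [ltLHS](@lebesgue_tuple_box R k (fun=> [set` `[- n%:R, n%:R]%R]))//.
rewrite ltey_eq; apply/orP; left.
apply: (big_ind (fun x => x \is a fin_num)) => [//|x y xfin yfin|i _].
  exact: fin_numM.
by rewrite lebesgue_measure_itv/=; case: ifP => _; rewrite -?EFinD.
Qed.

HB.instance Definition _ k := Measure_isSigmaFinite.Build _ _ _ (@tlebesgue k)
  (@sigma_finite_tlebesgue k).

Lemma ge0_integral_tlebesgueS k (f : k.+1.-tuple R -> \bar R) :
  measurable_fun [set: k.+1.-tuple R] f -> (forall a, 0 <= f a) ->
  \int[@tlebesgue k.+1]_a f a =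
  \int[@lebesgue_measure R]_x \int[@tlebesgue k]_a f [tuple of x :: a].
Proof.
move=> mf f0.
have mcons := @measurable_cons_pair R k.
rewrite /tlebesgue/= /lebesgue_cons ge0_integral_pushforward// preimage_setT.
(* The recursion uses the product [\x^], Tonelli the product [\x]; they agree on rectangles, hence
   everywhere by uniqueness. *)
transitivity (\int[(@lebesgue_measure R \x @tlebesgue k)%E]_p f (cons_pair p)).
  apply: eq_measure_integral => A mA _.
  by apply/esym/product_measure_unique => // B C mB mC; rewrite /= product_measure2E.
by rewrite fubini_tonelli1//; exact: measurableT_comp mf mcons.
Qed.

End lebesgue_tuple_sigma_finite.

(** * Gaussian integrals *)

Section gaussian.
Variable R : realType.
Local Notation mu := (@lebesgue_measure R).

(** This is the normalization of the normal law with mean -b and variance 1/(2D). *)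
Lemma integral_gauss_shift (D b : R) : 0 < D ->
  (\int[mu]_x (expR (- (D * (x + b) ^+ 2)))%:E = (Num.sqrt (pi / D))%:E)%E.
Proof.
move=> D0; pose s := Num.sqrt ((2 * D)^-1).
have s2 : s ^+ 2 = (2 * D)^-1 by rewrite sqr_sqrtr// invr_ge0 mulr_ge0// ltW.
have s0 : s != 0 by rewrite gt_eqF// sqrtr_gt0 invr_gt0 mulr_gt0.
have sE : s ^+ 2 *+ 2 = D^-1 by rewrite s2 -mulr_natr; field; rewrite gt_eqF.
have pE : normal_peak s = (Num.sqrt (pi / D))^-1.
  by congr (Num.sqrt _)^-1; rewrite mulrC -mulrnAr sE.
have := integral_normal_pdf (- b) s; rewrite normal_pdfE//.
under eq_integral do rewrite EFinM.
rewrite ge0_integralZl_EFin//=; last 3 first.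
- by move=> x _; rewrite lee_fin normal_fun_ge0.
- by apply/measurable_EFinP; exact: measurable_normal_fun.
- exact: normal_peak_ge0.
rewrite pE => H.
have q0 : Num.sqrt (pi / D) != 0 by rewrite gt_eqF// sqrtr_gt0 divr_gt0// pi_gt0.
transitivity ((Num.sqrt (pi / D))%:E * 1)%E; last by rewrite mule1.
rewrite -H muleA -EFinM divff// mul1e; apply: eq_integral => x _.
by rewrite /normal_fun sE opprK invrK; congr (expR _)%:E; ring.
Qed.

(** Complete the square in x. Negative [l] is allowed, as the large values of the logarithm call for
    [l = - t / 2]. *)
Lemma integral_gauss_affine (t l y c : R) : 0 < t -> 0 < t + l * y ^+ 2 ->
  (\int[mu]_x (expR (- (t * x ^+ 2) - l * (x * y + c) ^+ 2))%:E =
   (Num.sqrt (pi / t) * Num.sqrt (t / (t + l * y ^+ 2)) *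
    expR (- (l * t / (t + l * y ^+ 2) * c ^+ 2)))%:E)%E.
Proof.
move=> t0; set D := t + _ => D0.
under eq_integral => x _.
  rewrite (_ : _ - _ = - (D * (x + l * y * c / D) ^+ 2)
     + - (l * t / D * c ^+ 2)); last first.
    by rewrite /D; field; rewrite -/D gt_eqF.
  rewrite expRD EFinM; over.
rewrite ge0_integralZr//=; last first.
  apply/measurable_EFinP; apply: measurableT_comp => //.
  apply: measurableT_comp => //; apply: measurable_funM => //.
  by apply: measurable_funX; exact: measurable_funD.
rewrite integral_gauss_shift// -EFinM -sqrtrM; last first.
  by rewrite divr_ge0 ?pi_ge0// ltW.
by congr ((Num.sqrt _ * _)%:E); field; rewrite !gt_eqF.
Qed.

Definition sqnorm k (a : k.-tuple R) : R := \sum_(i < k) tnth a i ^+ 2.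
Definition dotp k (x : 'I_k -> R) (a : k.-tuple R) : R :=
  \sum_(i < k) tnth a i * x i.

Lemma measurable_sqnorm k : measurable_fun [set: k.-tuple R] (@sqnorm k).
Proof.
by apply: measurable_sum => j; apply: measurable_funX; exact: measurable_tnth.
Qed.

Lemma measurable_dotp k (x : 'I_k -> R) : measurable_fun [set: k.-tuple R] (dotp x).
Proof.
by apply: measurable_sum => j; apply: measurable_funM => //; exact: measurable_tnth.
Qed.

Lemma sqnorm_ge0 k (a : k.-tuple R) : 0 <= sqnorm a.
Proof. by apply: sumr_ge0 => i _; rewrite sqr_ge0. Qed.

Lemma sqnorm_cons k y (a : k.-tuple R) :
  sqnorm [tuple of y :: a] = y ^+ 2 + sqnorm a.
Proof.
rewrite /sqnorm big_ord_recl tnth0; congr (_ + _).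
by apply: eq_bigr => i _; rewrite tnthS.
Qed.

Lemma dotp_cons k (x : 'I_k.+1 -> R) y (a : k.-tuple R) :
  dotp x [tuple of y :: a] = y * x ord0 + dotp (x \o lift ord0) a.
Proof.
rewrite /dotp big_ord_recl tnth0; congr (_ + _).
by apply: eq_bigr => i _; rewrite tnthS.
Qed.

Lemma measurable_gauss_tuple k (x : 'I_k -> R) (t l c : R) :
  measurable_fun [set: k.-tuple R]
    (fun a => (expR (- (t * sqnorm a) - l * (dotp x a + c) ^+ 2))%:E).
Proof.
apply/measurable_EFinP; apply: measurableT_comp => //; apply: measurable_funB.
  apply: measurableT_comp => //; apply: measurable_funM => //.
  exact: measurable_sqnorm.
apply: measurable_funM => //; apply: measurable_funX.
by apply: measurable_funD => //; exact: measurable_dotp.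
Qed.

(** Induction on [k], with [l] and [c] general: for a fixed first coordinate y, the tail sees the
    offset y x_0 + c, and integrating it out replaces [l] by [l * t / D']. *)
Lemma integral_gauss_tuple k (x : 'I_k -> R) (t l c : R) :
  let D := t + l * \sum_(i < k) x i ^+ 2 in 0 < t -> 0 < D ->
  (\int[@tlebesgue R k]_a
      (expR (- (t * sqnorm a) - l * (dotp x a + c) ^+ 2))%:E =
   (Num.sqrt (pi / t) ^+ k * Num.sqrt (t / D) *
    expR (- (l * t / D * c ^+ 2)))%:E)%E.
Proof.
elim: k => [|k IH] in x l c *; move=> D t0 D0.
  rewrite /tlebesgue/= integral_dirac//; last exact: measurable_gauss_tuple.
  rewrite diracT mul1e /sqnorm /dotp /D !big_ord0.
  rewrite !mulr0 !addr0 add0r oppr0 sub0r expr0 divff ?gt_eqF// sqrtr1 !mul1r.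
  by rewrite mulfK ?gt_eqF.
rewrite ge0_integral_tlebesgueS//; last exact: measurable_gauss_tuple.
pose x' := x \o lift ord0; pose S' := \sum_(i < k) x' i ^+ 2.
pose D' := t + l * S'.
have DE : D = D' + l * x ord0 ^+ 2.
  by rewrite /D /D' big_ord_recl mulrDr addrA addrAC.
have S'0 : 0 <= S' by apply: sumr_ge0 => i _; exact: sqr_ge0.
(* For [l < 0], dropping a coordinate only increases the denominator, so [D <= D']. *)
have D'0 : 0 < D'.
  have [l0|l0] := leP 0 l; first by rewrite ltr_wpDr// mulr_ge0.
  by apply: (lt_le_trans D0); rewrite DE gerDl mulr_le0_ge0 ?sqr_ge0// ltW.
under eq_integral => y _.
  under eq_integral => a _.
    rewrite sqnorm_cons dotp_cons -/x' mulrDr opprD.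
    rewrite (addrC (y * _)) -(addrA (dotp _ _)) -addrA expRD EFinM; over.
  rewrite /= ge0_integralZl_EFin//=; last exact: measurable_gauss_tuple.
  rewrite IH ?expR_ge0// -/D' -EFinM mulrCA -expRD; over.
rewrite /=.
under eq_integral do rewrite EFinM.
(* This new denominator equals tD/D', so the factors sqrt(t/D') and sqrt(D'/D) telescope to
   sqrt(t/D). *)
have D''0 : 0 < t + l * t / D' * x ord0 ^+ 2.
  rewrite (_ : _ + _ = t * D / D') ?divr_gt0 ?mulr_gt0//.
  by rewrite DE; field; rewrite gt_eqF.
rewrite ge0_integralZl_EFin//=; last first.
  apply/measurable_EFinP; apply: measurableT_comp => //; apply: measurable_funB.
    by apply: measurableT_comp => //; exact: measurable_funM.
  apply: measurable_funM => //; apply: measurable_funX.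
  by apply: measurable_funD => //; exact: mulrr_measurable.
rewrite integral_gauss_affine// -EFinM; congr EFin.
have -> : t + l * t / D' * x ord0 ^+ 2 = t * D / D'.
  by rewrite DE; field; rewrite gt_eqF.
have -> : l * t / D' * t / (t * D / D') = l * t / D.
  by field; rewrite !gt_eqF.
have -> : Num.sqrt (t / D) = Num.sqrt (t / D') * Num.sqrt (t / (t * D / D')).
  rewrite -sqrtrM ?divr_ge0 ?ltW//; congr Num.sqrt.
  by field; rewrite !gt_eqF.
by rewrite (exprS _ k); ring.
Qed.

End gaussian.

(** * The Gamma function *)

Section gamma.
Variable R : realType.
Local Notation mu := (@lebesgue_measure R).

(** Put L = (b/c) z; then ln z <= z gives z^b <= e^(bz) = e^(cL). *)
Lemma powR_le_expR (b c L : R) : 0 < b -> 0 < c -> 0 <= L ->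
  L `^ b <= (b / c) `^ b * expR (c * L).
Proof.
move=> b0 c0; rewrite le_eqVlt => /predU1P[<-|L0].
  by rewrite powR0 ?gt_eqF// mulr_ge0 ?powR_ge0 ?expR_ge0.
have z0 : 0 < c * L / b by rewrite divr_gt0 ?mulr_gt0.
rewrite {1}(_ : L = b / c * (c * L / b)); last by field; rewrite !gt_eqF.
have bc0 : 0 < b / c by rewrite divr_gt0.
rewrite (powRM _ (ltW bc0) (ltW z0)) ler_wpM2l ?powR_ge0//.
rewrite /powR gt_eqF// ler_expR -[leRHS](divfK (lt0r_neq0 b0)) mulrC.
by rewrite ler_wpM2r ?ltW// ln_sublinear.
Qed.

Lemma measurable_gamma_fun (s c : R) :
  measurable_fun [set: R] (fun t => t `^ (s - 1) * expR (- (c * t))).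
Proof.
apply: measurable_funM; first exact: measurable_powR.
by apply: measurableT_comp => //; apply: measurableT_comp => //; exact: measurable_funM.
Qed.

(** Exhaust ]0, 1] by the intervals [1/(n+1), 1], on which the antiderivative t^s / s bounds the
    integral by 1/s. *)
Lemma integral_powR_lty (s : R) : 0 < s ->
  (\int[mu]_(t in `]0%R, 1%R]) (t `^ (s - 1))%:E < +oo)%E.
Proof.
move=> s0; pose F n := `[(n.+1%:R : R)^-1, 1]%classic.
have FE : `]0%R, 1%R]%classic = \bigcup_n F n.
  apply/seteqP; split => [t|t [n _]]; rewrite /F/= !in_itv/= => /andP[t0 t1].
    exists (Num.bound t^-1) => //=; rewrite in_itv/= t1 andbT.
    rewrite invf_ple ?posrE//.
    apply/ltW/(lt_le_trans (archi_boundP _)); first by rewrite invr_ge0 ltW.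
    by rewrite ler_nat.
  by rewrite t1 andbT (lt_le_trans _ t0).
have mp : measurable_fun [set: R] (fun t : R => (t `^ (s - 1))%:E).
  by apply/measurable_EFinP; exact: measurable_powR.
have H : (\int[mu]_(t in F i) (t `^ (s - 1))%:E @[i --> \oo] -->
    \int[mu]_(t in \bigcup_i F i) (t `^ (s - 1))%:E)%E.
  apply: ge0_nondecreasing_set_cvg_integral.
  - apply/nondecreasing_seqP => n; apply/subsetPset => t.
    rewrite /F/= !in_itv/= => /andP[nt ->]; rewrite andbT (le_trans _ nt)//.
    by rewrite lef_pV2 ?posrE// ler_nat.
  - by move=> n; exact: measurable_itv.
  - by move=> n; exact: measurable_funTS.
  - by move=> n t _; rewrite lee_fin powR_ge0.
rewrite FE; apply: (@le_lt_trans _ _ (s^-1)%:E); last by rewrite ltry.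
rewrite -(cvg_lim _ H)//; apply: lime_le; first by apply/cvg_ex; eexists; exact: H.
(* For n = 0 the interval is the point 1; the fundamental theorem of calculus needs distinct
   endpoints. *)
apply: nearW => n; have [->|n0] := eqVneq n 0%N.
  by rewrite /F invr1 set_itv1 integral_set1 lee_fin invr_ge0 ltW.
have n1 : (n.+1%:R)^-1 < 1 :> R.
  by rewrite invf_lt1 ?posrE// ltr1n ltnS lt0n.
have cp (a x : R) : 0 < x -> {for x, continuous (fun t => t `^ a)}.
  move=> x0; apply/differentiable_continuous/derivable1_diffP/derivable_powR.
  by rewrite in_itv/= x0.
rewrite /F (@continuous_FTC2 _ _ (fun t => s^-1 * t `^ s))//.
- rewrite powR1 mulr1 -EFinB lee_fin gerBl mulr_ge0 ?invr_ge0 ?powR_ge0// ltW//.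
- apply: continuous_in_subspaceT => x; rewrite inE/= in_itv/= => /andP[x0 _].
  by apply: cp; rewrite (lt_le_trans _ x0).
- split.
  + move=> x; rewrite in_itv/= => /andP[x0 _]; apply: derivableM => //.
    by apply: derivable_powR; rewrite in_itv/= (lt_trans _ x0).
  + apply: cvg_at_right_filter; apply: cvgM; first exact: cvg_cst.
    by apply: cp; rewrite invr_gt0.
  + apply: cvg_at_left_filter; apply: cvgM; first exact: cvg_cst.
    exact: cp.
- move=> x; rewrite in_itv/= => /andP[x0 _].
  have x0' : 0 < x by rewrite (lt_trans _ x0).
  rewrite derive1E deriveM//; last first.
    by apply: derivable_powR; rewrite in_itv/= x0'.
  rewrite derive_cst scaler0 addr0 -derive1E powR_derive1 ?in_itv/= ?x0'//.
  by rewrite /GRing.scale/= mulrA mulVf ?mul1r// gt_eqF.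
Qed.

(** Split at 1: t^(s-1) dominates on ]0, 1], a multiple of the exponential density of rate 1/2
    beyond. *)
Lemma integral_gamma_lty (s : R) : 0 < s ->
  (\int[mu]_(t in `]0%R, +oo[) (t `^ (s - 1) * expR (- t))%:E < +oo)%E.
Proof.
move=> s0.
have mg : measurable_fun [set: R] (fun t : R => (t `^ (s - 1) * expR (- t))%:E).
  apply/measurable_EFinP; have := measurable_gamma_fun s 1.
  by under eq_fun do rewrite mul1r.
have -> : `]0%R, +oo[%classic = `]0%R, 1%R] `|` `]1%R, +oo[ :> set R.
  by rewrite -(@itv_bndbnd_setU _ _ _ (BRight 1)) ?bnd_simp.
rewrite ge0_integral_setU//=; last 3 first.
- exact: measurable_funTS.
- by move=> t _; rewrite lee_fin mulr_ge0 ?powR_ge0 ?expR_ge0.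
- by apply/disj_setPS => t [] /=; rewrite !in_itv/= => /andP[_ t1]; rewrite andbT ltNge t1.
apply: lte_add_pinfty.
  apply: le_lt_trans (integral_powR_lty s0); apply: ge0_le_integral => //.
  - by move=> t _; rewrite lee_fin mulr_ge0 ?powR_ge0 ?expR_ge0.
  - exact: measurable_funTS.
  - by apply/measurable_EFinP/measurable_funTS; exact: measurable_powR.
  - move=> t /=; rewrite in_itv/= => /andP[t0 _]; rewrite lee_fin.
    by rewrite ler_piMr ?powR_ge0// expR_le1 oppr_le0 ltW.
(* [b] is positive and at least s - 1, so t^(s-1) <= t^b <= (2b)^b e^(t/2) for t > 1; the 2 in [K]
   cancels the rate 1/2 in the density. *)
pose b := `|s - 1| + 1; pose K := 2 * (b * 2) `^ b.
have b0 : 0 < b by rewrite ltr_pwDr.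
apply: (@le_lt_trans _ _ (\int[mu]_t (K%:E * (exponential_pdf 2^-1 t)%:E))%E).
  rewrite integral_mkcond; apply: ge0_le_integral => //.
  - by move=> t _; apply: erestrict_ge0 => x _; rewrite lee_fin mulr_ge0 ?powR_ge0 ?expR_ge0.
  - by apply/(measurable_restrictT _ _).1 => //; exact: measurable_funTS.
  - apply: emeasurable_funM => //.
    by apply/measurable_EFinP; exact: measurable_exponential_pdf.
  - move=> t _; rewrite patchE; case: ifPn => [|_]; last first.
      by rewrite mule_ge0// lee_fin ?exponential_pdf_ge0// mulr_ge0// powR_ge0.
    rewrite inE/= in_itv/= andbT => t1; rewrite -EFinM lee_fin.
    have t0 : 0 <= t by rewrite ltW// (lt_trans _ t1).
    rewrite exponential_pdfE//.
    rewrite (_ : K * _ = (b * 2) `^ b * expR (- 2^-1 * t)); last by rewrite /K; field.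
    rewrite (_ : - 2^-1 * t = 2^-1 * t - t); last by field.
    rewrite expRD mulrA ler_wpM2r ?expR_ge0//.
    apply: (@le_trans _ _ (t `^ b)).
      by apply: (ler_powR (ltW t1)); rewrite (le_trans (ler_norm _))// lerDl.
    by have := @powR_le_expR b 2^-1 t b0; rewrite invrK => ->.
rewrite ge0_integralZl_EFin//.
- by rewrite integral_exponential_pdf// mule1 ltry.
- by move=> t _; rewrite lee_fin exponential_pdf_ge0.
- by apply/measurable_EFinP; exact: measurable_exponential_pdf.
- by rewrite mulr_ge0// powR_ge0.
Qed.

(** The real-valued integral in [Gamma] would send an infinite value to 0; finiteness excludes
    this. *)
Lemma GammaE (s : R) : 0 < s ->
  (\int[mu]_(t in `]0%R, +oo[) (t `^ (s - 1) * expR (- t))%:E)%E = (Gamma s)%:E.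
Proof.
move=> s0; rewrite /Gamma /Rintegral fineK// ge0_fin_numE ?integral_gamma_lty//.
by apply: integral_ge0 => t _; rewrite lee_fin mulr_ge0 ?powR_ge0 ?expR_ge0.
Qed.

Lemma Gamma_gt0 (s : R) : 0 < s -> 0 < Gamma s.
Proof.
move=> s0; rewrite -lte_fin -GammaE//.
(* A lower bound for the integrand on [1, 2], where 0 <= ln t <= 1 and t <= 2. *)
pose m := expR (- `|s - 1| - 2).
apply: (@lt_le_trans _ _ (\int[mu]_(t in `[1%R, 2%R]) m%:E)%E).
  rewrite integral_cst//= lebesgue_measure_itv/= lte_fin ltr1n -EFinD.
  by rewrite -EFinM lte_fin mulr_gt0 ?expR_gt0// subr_gt0 ltr1n.
apply: (@le_trans _ _
    (\int[mu]_(t in `[1%R, 2%R]) (t `^ (s - 1) * expR (- t))%:E)%E); last first.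
  apply: ge0_subset_integral => //.
  - apply/measurable_EFinP/measurable_funTS; have := measurable_gamma_fun s 1.
    by under eq_fun do rewrite mul1r.
  - by move=> t _; rewrite lee_fin mulr_ge0 ?powR_ge0 ?expR_ge0.
  - by move=> t /=; rewrite !in_itv/= andbT => /andP[t1 _]; rewrite (lt_le_trans _ t1).
apply: ge0_le_integral => //.
- by move=> t _; rewrite lee_fin expR_ge0.
- apply/measurable_EFinP/measurable_funTS; have := measurable_gamma_fun s 1.
  by under eq_fun do rewrite mul1r.
- move=> t /=; rewrite in_itv/= => /andP[t1 t2]; rewrite lee_fin.
  have t0 : 0 < t by rewrite (lt_le_trans _ t1).
  rewrite /powR gt_eqF// -expRD ler_expR lerD ?lerN2//.
  rewrite -(opprK (_ * ln _)) lerN2 (le_trans (ler_norm _))// normrN normrM.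
  rewrite ler_piMr// ger0_norm ?ln_ge0// -(subrKC 1 t).
  by rewrite (le_trans (le_ln1Dx _))//; lra.
Qed.

Lemma integral_gamma_scale (s c : R) : 0 < s -> 0 < c ->
  (\int[mu]_(t in `]0%R, +oo[) (t `^ (s - 1) * expR (- (c * t)))%:E)%E =
  (Gamma s * c `^ (- s))%:E.
Proof.
move=> s0 c0; rewrite EFinM -GammaE// integral_mkcond.
have m1 : measurable_fun [set: R] (fun t : R => (t `^ (s - 1) * expR (- t))%:E).
  apply/measurable_EFinP; have := measurable_gamma_fun s 1.
  by under eq_fun do rewrite mul1r.
rewrite [in RHS]integral_mkcond [in RHS](ge0_integral_lebesgue_scale c0); last 2 first.
- by apply/(measurable_restrictT _ _).1 => //; exact: measurable_funTS.
- by move=> t; apply: erestrict_ge0 => x _; rewrite lee_fin mulr_ge0 ?powR_ge0 ?expR_ge0.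
(* After substituting ct for t, c comes from dt and c^(s-1) from the power of t. *)
have cE : c * c `^ (- s) * c `^ (s - 1) = 1.
  rewrite -mulrA -powRD ?(gt_eqF c0) ?implybT// addKr.
  by rewrite powR_inv1 ?ltW// mulfV// gt_eqF.
rewrite muleAC -EFinM -ge0_integralZl_EFin//.
- apply: eq_integral => t _; rewrite !patchE !mem_setE !in_itv/= !andbT pmulr_rgt0//.
  case: ifPn => t0; last by rewrite mule0.
  by rewrite -EFinM powRM ?ltW// !mulrA cE mul1r.
- by move=> t _; apply: erestrict_ge0 => x _; rewrite lee_fin mulr_ge0 ?powR_ge0 ?expR_ge0.
- rewrite (_ : (fun t => _) = ((fun t : R => (t `^ (s - 1) * expR (- t))%:E) \_ `]0, +oo[)
     \o ( *%R c))//.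
  apply: measurableT_comp; last exact: mulrl_measurable.
  by apply/(measurable_restrictT _ _).1 => //; exact: measurable_funTS.
- by rewrite mulr_ge0 ?powR_ge0// ltW.
Qed.

End gamma.

(** * The measure sigma as a mixture of Gaussians *)

Section mixture.
Variables (R : realType) (k : nat) (alpha : R).
Hypothesis alpha0 : 0 < alpha.
Local Notation mu := (@lebesgue_measure R).

Let s := k%:R / 2 + alpha.
Let s0 : 0 < s. Proof. by rewrite ltr_wpDl// divr_ge0. Qed.

(* The normalization pi^(k/2) and the factor t^(k/2) of the Gaussian laws are
   kept in the weight; see [mix_weight_gauss]. *)
Definition mix_weight (t : R) : R := \1_(`]0, +oo[) t *
  (t `^ (k%:R / 2 + alpha - 1) * expR (- t) / (Gamma alpha * pi `^ (k%:R / 2))).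

Lemma mix_weight_ge0 t : 0 <= mix_weight t.
Proof.
rewrite mulr_ge0// divr_ge0 ?mulr_ge0 ?powR_ge0 ?expR_ge0//.
by rewrite ltW// Gamma_gt0.
Qed.

Lemma mix_weight_le0 t : t <= 0 -> mix_weight t = 0.
Proof.
move=> t0; rewrite /mix_weight indicE memNset ?mul0r//=.
by rewrite in_itv/= andbT ltNge t0.
Qed.

Lemma measurable_mix_weight : measurable_fun [set: R] mix_weight.
Proof.
apply: measurable_funM; first exact: measurable_indic.
apply: measurable_funM => //; have := measurable_gamma_fun s 1.
by under eq_fun do rewrite mul1r.
Qed.

Lemma measurable_expR_sqnorm :
  measurable_fun [set: R * k.-tuple R] (fun p => expR (- (p.1 * sqnorm p.2))).
Proof.
apply: measurableT_comp => //; apply: measurableT_comp => //.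
apply: measurable_funM => //.
by apply: measurableT_comp => //; exact: measurable_sqnorm.
Qed.

Lemma sigma_densityE (a : k.-tuple R) : ((sigma_density alpha a)%:E =
  \int[mu]_t (mix_weight t * expR (- (t * sqnorm a)))%:E)%E.
Proof.
have c0 : 0 < 1 + sqnorm a by rewrite ltr_pwDl// sqnorm_ge0.
rewrite /sigma_density cvnorm_real -/(sqnorm a) -opprD -/s mulrAC EFinM.
rewrite -integral_gamma_scale// integral_mkcond -ge0_integralZr//.
- apply: eq_integral => t _; rewrite patchE /mix_weight indicE.
  case: ifPn => _; last by rewrite !mul0r mul0e.
  rewrite -EFinM mul1r -/s mulrDl mul1r (mulrC (sqnorm a)) opprD expRD.
  by congr EFin; field; rewrite gt_eqF ?powR_gt0 ?pi_gt0//= gt_eqF ?Gamma_gt0.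
- apply/(measurable_restrictT _ _).1 => //; apply: measurable_funTS.
  by apply/measurable_EFinP; exact: measurable_gamma_fun.
- by move=> t _; apply: erestrict_ge0 => x _; rewrite lee_fin mulr_ge0 ?powR_ge0 ?expR_ge0.
- by rewrite lee_fin invr_ge0 mulr_ge0 ?powR_ge0// ltW// Gamma_gt0.
Qed.

(** Insert [sigma_densityE] for the density, then exchange t and a by Tonelli. *)
Lemma ge0_integral_sigma (g : k.-tuple R -> \bar R) :
  measurable_fun [set: k.-tuple R] g -> (forall a, 0 <= g a)%E ->
  (\int[@sigma R k alpha]_a g a = \int[mu]_t ((mix_weight t)%:E *
     \int[@tlebesgue R k]_a (g a * (expR (- (t * sqnorm a)))%:E)))%E.
Proof.
move=> mg g0.
rewrite (@ge0_integral_density _ _ _ (@tlebesgue R k) _ (sigma_density alpha))//; last 2 first.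
- exact: measurable_sigma_density.
- exact: sigma_density_ge0.
pose h (p : R * k.-tuple R) : \bar R :=
  ((mix_weight p.1)%:E * (g p.2 * (expR (- (p.1 * sqnorm p.2)))%:E))%E.
have mh : measurable_fun [set: R * k.-tuple R] h.
  apply: emeasurable_funM.
    by apply/measurable_EFinP; apply: measurableT_comp => //; exact: measurable_mix_weight.
  apply: emeasurable_funM; first exact: measurableT_comp.
  by apply/measurable_EFinP; exact: measurable_expR_sqnorm.
have h0 p : (0 <= h p)%E.
  by rewrite !mule_ge0// lee_fin ?mix_weight_ge0 ?expR_ge0.
have mE t : measurable_fun [set: k.-tuple R] (fun a => expR (- (t * sqnorm a))).
  apply: measurableT_comp => //; apply: measurableT_comp => //.
  by apply: measurable_funM => //; exact: measurable_sqnorm.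
transitivity (\int[@tlebesgue R k]_a \int[mu]_t h (t, a))%E.
  apply: eq_integral => a _; rewrite sigma_densityE -ge0_integralZl//.
  - by apply: eq_integral => t _; rewrite /h/= EFinM muleCA.
  - apply/measurable_EFinP; apply: measurable_funM.
      exact: measurable_mix_weight.
    apply: measurableT_comp => //; apply: measurableT_comp => //.
    exact: measurable_funM.
  - by move=> t _; rewrite lee_fin mulr_ge0 ?mix_weight_ge0 ?expR_ge0.
rewrite -(@fubini_tonelli _ _ (measurableTypeR R) _ R mu (@tlebesgue R k) h)//; apply: eq_integral => t _.
rewrite -ge0_integralZl//.
- by apply: emeasurable_funM => //; exact/measurable_EFinP.
- by move=> a _; rewrite mule_ge0// lee_fin expR_ge0.
- by rewrite lee_fin mix_weight_ge0.
Qed.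

(** The Gaussian mass (pi/t)^(k/2) cancels every trace of [k] in the weight, leaving the gamma law
    of parameter [alpha]. This makes the final constant independent of the dimension. *)
Lemma mix_weight_gauss (t : R) : mix_weight t * Num.sqrt (pi / t) ^+ k =
  \1_(`]0, +oo[) t * (t `^ (alpha - 1) * expR (- t) / Gamma alpha).
Proof.
rewrite /mix_weight indicE; have [|_] := boolP (t \in _); last by rewrite !mul0r.
rewrite inE/= in_itv/= andbT => t0; rewrite !mul1r.
have -> : Num.sqrt (pi / t) ^+ k = pi `^ (k%:R / 2) / t `^ (k%:R / 2).
  rewrite -powR12_sqrt ?divr_ge0 ?pi_ge0 ?ltW// -powR_mulrn ?powR_ge0//.
  rewrite -powRrM (mulrC 2^-1) powRM ?invr_ge0 ?pi_ge0 ?ltW//; congr (_ * _).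
  by rewrite -powR_inv1 ?ltW// -powRrM mulN1r powRN.
rewrite -addrA (@powRD _ t (k%:R / 2)) ?(gt_eqF t0) ?implybT//.
by field; rewrite !gt_eqF ?powR_gt0 ?pi_gt0 ?Gamma_gt0.
Qed.

(** A moment of that gamma law; [b] may be negative. *)
Lemma integral_mix_powR (b : R) : 0 < alpha + b ->
  (\int[mu]_t (mix_weight t * Num.sqrt (pi / t) ^+ k * t `^ b)%:E =
  (Gamma (alpha + b) / Gamma alpha)%:E)%E.
Proof.
move=> ab0; rewrite EFinM -GammaE// [in RHS]integral_mkcond -ge0_integralZr//.
- apply: eq_integral => t _; rewrite mix_weight_gauss patchE indicE.
  case: ifPn => [|_]; last by rewrite !mul0r mul0e.
  rewrite inE/= in_itv/= andbT => t0; rewrite -EFinM mul1r addrAC.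
  rewrite (@powRD _ t (alpha - 1)) ?(gt_eqF t0) ?implybT//; congr EFin.
  by field; rewrite !gt_eqF ?Gamma_gt0.
- apply/(measurable_restrictT _ _).1 => //; apply: measurable_funTS.
  apply/measurable_EFinP; have := measurable_gamma_fun (alpha + b) 1.
  by under eq_fun do rewrite mul1r.
- by move=> t _; apply: erestrict_ge0 => x _; rewrite lee_fin mulr_ge0 ?powR_ge0 ?expR_ge0.
- by rewrite lee_fin invr_ge0 ltW// Gamma_gt0.
Qed.

Lemma sigma_setT : sigma alpha [set: k.-tuple R] = 1%E.
Proof.
rewrite -[LHS]mul1e -(integral_cst (@sigma R k alpha))//.
rewrite ge0_integral_sigma//.
transitivity (Gamma (alpha + 0) / Gamma alpha)%:E; last first.
  by rewrite addr0 divff// gt_eqF// Gamma_gt0.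
rewrite -integral_mix_powR ?addr0//; apply: eq_integral => t _.
rewrite powRr0 mulr1; have [t0|t0] := leP t 0.
  by rewrite mix_weight_le0// mul0r mul0e.
rewrite [RHS]EFinM; congr (_ * _)%E.
(* With x, l and c zero this is the plain Gaussian mass, so the total mass is the moment of order
   0. *)
have := @integral_gauss_tuple R k (fun=> 0) t 0 0 t0.
rewrite mul0r addr0 divff ?gt_eqF// sqrtr1 mulr1 !mul0r oppr0 expR0 mulr1.
move=> <-//; apply: eq_integral => a _.
by rewrite /= mul1e mul0r subr0.
Qed.

End mixture.

(** * Logarithmic moments *)

Section log_bound.
Variable R : realType.

(* Dominates a multiple of s^(-1/4) for 0 < s <= 1: the terms with 16^n s <= 1
   are at least 2^n / e. *)
Definition small_sum (s : R) : \bar R :=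
  (\sum_(0 <= n <oo) (2 ^+ n * expR (- (16 ^+ n * s)))%:E)%E.

Let term_ge0 (s : R) n : (0 <= (2 ^+ n * expR (- (16 ^+ n * s)))%:E)%E.
Proof. by rewrite lee_fin mulr_ge0 ?exprn_ge0 ?expR_ge0. Qed.

Lemma small_sum_ge0 s : (0 <= small_sum s)%E.
Proof. by apply: nneseries_ge0 => n _ _; exact: term_ge0. Qed.

Lemma small_sum_ge s n :
  ((2 ^+ n * expR (- (16 ^+ n * s)))%:E <= small_sum s)%E.
Proof.
apply: le_trans (nneseries_lim_ge n.+1 _); last by move=> i _ _; exact: term_ge0.
by rewrite big_nat_recr//= leeDr// sume_ge0.
Qed.

Lemma small_sum0 : small_sum 0 = +oo%E.
Proof.
apply/eqyP => A A0; apply: le_trans (small_sum_ge 0 (Num.bound A)).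
rewrite mulr0 oppr0 expR0 mulr1 lee_fin -natrX.
apply/ltW/(lt_le_trans (archi_boundP (ltW A0))).
by rewrite ler_nat ltnW// ltn_expl.
Qed.

(** Used with r = |<a,u>| and s = <a,x>^2. First (-ln r)^nu <= c r^(-1/2); then one well-chosen term
    of the series dominates r^(-1/2). *)
Lemma powR_lnN_small (nu : R) : 0 < nu -> exists2 K : R, 0 < K &
  forall r s, 0 < r -> r <= 1 -> 0 <= s -> s <= r ^+ 2 ->
  (((- ln r) `^ nu)%:E <= K%:E * small_sum s)%E.
Proof.
move=> nu0; pose c : R := (nu / 2^-1) `^ nu.
have c0 : 0 < c by rewrite powR_gt0// divr_gt0// invr_gt0.
have K0 : 0 < c * 2 * expR 1 by rewrite !mulr_gt0// expR_gt0.
exists (c * 2 * expR 1) => // r s r0 r1.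
rewrite le_eqVlt => /predU1P[<- _|s0 sr].
  by rewrite small_sum0 gt0_muley ?lte_fin// leey.
have [n ns] : exists n, (16 ^+ n.+1)^-1 <= s.
  exists (Num.bound s^-1); rewrite invf_ple ?posrE ?exprn_gt0//.
  have s0' : 0 <= s^-1 by rewrite invr_ge0 ltW.
  apply/ltW/(lt_le_trans (archi_boundP s0')).
  by rewrite -natrX ler_nat ltnW// (leq_trans _ (ltnW (ltn_expl _ _))).
have exn : exists n, (16 ^+ n.+1)^-1 <= s by exists n.
(* The least such m also satisfies 16^m s <= 1, by minimality or, if m = 0, by s <= r^2 <= 1. The
   m-th term is then at least 2^m / e, whence the factor 2e in the constant. *)
have [m ms mmin] := ex_minnP exn.
have sm : 16 ^+ m * s <= 1.
  case: m => [|m] in ms mmin *.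
    by rewrite expr0 mul1r (le_trans sr)// expr_le1// ltW.
  rewrite -ler_pdivlMl ?exprn_gt0// mulr1 leNgt; apply/negP => sm.
  by have := mmin m (ltW sm); rewrite ltnn.
apply: le_trans (lee_wpmul2l _ (small_sum_ge s m)); last by rewrite lee_fin ltW.
rewrite -EFinM lee_fin.
have L0 : 0 <= - ln r by rewrite oppr_ge0 ln_le0.
have half0 : 0 < 2^-1 :> R by rewrite invr_gt0.
apply: le_trans (powR_le_expR nu0 half0 L0) _.
rewrite -/c -!mulrA ler_wpM2l ?(ltW c0)//.
have -> : 2 * (expR 1 * (2 ^+ m * expR (- (16 ^+ m * s)))) =
    expR (- (16 ^+ m * s) + 1) * 2 ^+ m.+1 by rewrite expRD exprS; ring.
have e1 : 1 <= expR (- (16 ^+ m * s) + 1).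
  by rewrite -[leLHS]expR0 ler_expR addrC subr_ge0.
apply: (@le_trans _ _ (2 ^+ m.+1)); last by rewrite ler_peMl// exprn_ge0.
(* Compare fourth powers: r^(-2) <= 1/s <= 16^(m+1). *)
rewrite -(@ler_pXn2r _ 4) ?nnegrE ?expR_ge0 ?exprn_ge0//.
rewrite -exprM mulnC exprM -expRM_natl.
rewrite (_ : _ * _ = - ln (r ^+ 2)); last by rewrite lnXn//; field.
rewrite expRN lnK ?posrE ?exprn_gt0// invf_ple ?posrE ?exprn_gt0//.
apply: le_trans sr; rewrite (_ : 2 ^+ 4 = 16)//; by ring.
Qed.

Lemma powR_ln_large (nu p r : R) : 0 < nu -> 0 < p -> 1 <= r ->
  (ln r) `^ nu <= (nu / (2 * p)) `^ nu * (r ^+ 2) `^ p.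
Proof.
move=> nu0 p0 r1; have r0 : 0 < r by rewrite (lt_le_trans _ r1).
have p20 : 0 < 2 * p by rewrite mulr_gt0.
apply: le_trans (powR_le_expR nu0 p20 (ln_ge0 r1)) _.
rewrite ler_wpM2l ?powR_ge0// /powR gt_eqF ?exprn_gt0// lnXn//.
by rewrite ler_expR le_eqVlt; apply/orP; left; apply/eqP; ring.
Qed.

Lemma lne_powR_bound (nu p : R) : 0 < nu -> 0 < p -> exists2 K : R, 0 < K &
  forall r s, 0 <= r -> 0 <= s -> s <= r ^+ 2 ->
  (`|lne r%:E| `^ nu <= K%:E * (small_sum s + ((r ^+ 2) `^ p)%:E))%E.
Proof.
move=> nu0 p0; have [K K0 HK] := powR_lnN_small nu0.
pose c : R := (nu / (2 * p)) `^ nu.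
have c0 : 0 <= c by rewrite powR_ge0.
exists (K + c) => [|r s]; first by rewrite ltr_pwDl.
have pow0 (x : R) : (0 <= (x `^ p)%:E)%E by rewrite lee_fin powR_ge0.
(* At r = 0 the logarithm is -oo; s is then 0 too, and the right-hand side is +oo. *)
rewrite le_eqVlt => /predU1P[<- s0|r0 s0 sr].
  rewrite expr0n/= => s0'; have -> : s = 0 by apply/eqP; rewrite eq_le s0 s0'.
  rewrite small_sum0 addye// gt0_muley ?leey// lte_fin ltr_pwDl//.
rewrite lne_EFin//= ge0_muleDr ?small_sum_ge0//.
have [r1|r1] := leP r 1.
  rewrite ler0_norm ?ln_le0//; apply: le_trans (HK _ _ r0 r1 s0 sr) _.
  rewrite -[leLHS]adde0 leeD//.
    by rewrite lee_wpmul2r ?small_sum_ge0// lee_fin lerDl.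
  by rewrite mule_ge0// lee_fin addr_ge0// ltW.
rewrite ger0_norm ?ln_ge0 ?(ltW r1)// -[leLHS]add0e leeD//.
  by rewrite mule_ge0 ?small_sum_ge0// lee_fin addr_ge0// ltW.
rewrite -EFinM lee_fin; apply: le_trans (powR_ln_large nu0 p0 (ltW r1)) _.
by rewrite ler_wpM2r ?powR_ge0// lerDr ltW.
Qed.

(** With w = t(X^2 + Y^2), use w^p <= 1 + w, then 1 + v <= e^v at v = tX^2/2 and v = tY^2/2. The
    rate t/2 keeps the product with e^(-t|a|^2) integrable. *)
Lemma powR_le_gauss (t X Y p : R) : 0 < t -> 0 < p -> p <= 1 ->
  (X ^+ 2 + Y ^+ 2) `^ p <=
  t `^ (- p) * (2 * (expR (t / 2 * X ^+ 2) + expR (t / 2 * Y ^+ 2))).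
Proof.
move=> t0 p0 p1; set z := X ^+ 2 + Y ^+ 2.
have z0 : 0 <= z by rewrite addr_ge0 ?sqr_ge0.
have tz0 : 0 <= t * z by rewrite mulr_ge0// ltW.
have -> : z `^ p = t `^ (- p) * (t * z) `^ p.
  by rewrite powRM ?(ltW t0)// mulrA powRN mulVf ?mul1r// gt_eqF ?powR_gt0.
rewrite ler_wpM2l ?powR_ge0//; apply: (@le_trans _ _ (1 + t * z)).
  have [tz1|tz1] := leP (t * z) 1.
    apply: (@le_trans _ _ 1); last by rewrite lerDl.
    have H := @ge0_ler_powR R p (ltW p0) (t * z) 1.
    by rewrite powR1 in H; rewrite H ?nnegrE.
  by rewrite (le_trans (ler1_powR (ltW tz1) p1))// lerDr.
have hX := expR_ge1Dx (t / 2 * X ^+ 2); have hY := expR_ge1Dx (t / 2 * Y ^+ 2).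
rewrite /z; lra.
Qed.

(** * Gaussian integrals of the dominating functions *)

Section tuple.
Variables (k : nat) (t : R).
Hypothesis t0 : 0 < t.
Let q : R := Num.sqrt (pi / t) ^+ k.
Let q0 : 0 <= q. Proof. by rewrite exprn_ge0 ?sqrtr_ge0. Qed.

Lemma gauss_small (z : 'I_k -> R) : 2^-1 <= \sum_(i < k) z i ^+ 2 ->
  (\int[@tlebesgue R k]_a
     (small_sum (dotp z a ^+ 2) * (expR (- (t * sqnorm a)))%:E) <=
   (q * (4 * t `^ 2^-1))%:E)%E.
Proof.
set S := \sum_(i < k) _ => S0.
under eq_integral => a _.
  rewrite muleC -nneseriesZl; last by move=> n _; exact: term_ge0.
  under eq_eseriesr => n _.
    rewrite -EFinM mulrCA -expRD.
    rewrite -[X in 16 ^+ n * X ^+ 2]addr0 EFinM; over.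
  over.
rewrite integral_nneseries//=; last first.
  by move=> n; apply: emeasurable_funM => //; exact: measurable_gauss_tuple.
have Q0 : 0 <= q * (4 * t `^ 2^-1) by rewrite !mulr_ge0 ?powR_ge0.
(* Geometric series: the n-th integral is at most q 2^n (2 t^(1/2) / 4^n) = q (4 t^(1/2)) /
   2^(n+1). *)
apply: le_trans (epsilon_trick0 xpredT Q0).
apply: lee_nneseries => [n _ _|n _].
  by apply: integral_ge0 => a _; rewrite mule_ge0// lee_fin ?exprn_ge0 ?expR_ge0.
rewrite ge0_integralZl_EFin//=; last exact: measurable_gauss_tuple.
have D0 : 0 < t + 16 ^+ n * S.
  by rewrite ltr_wpDr// mulr_ge0 ?exprn_ge0// (le_trans _ S0)// invr_ge0.
rewrite integral_gauss_tuple// expr0n/= mulr0 oppr0 expR0 mulr1 -/q -EFinM lee_fin.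
rewrite mulrCA -mulrA ler_wpM2l// -ler_pdivlMl ?exprn_gt0//.
rewrite powR12_sqrt ?(ltW t0)// -/S.
apply: (@le_trans _ _ (Num.sqrt (4 * t * ((4 ^+ n)^-1) ^+ 2))).
  rewrite ler_wsqrtr// ler_pdivrMr// exprVn -exprM mulnC exprM.
  rewrite (_ : 4 ^+ 2 = 16 :> R); last by ring.
  have A0 : 0 < 16 ^+ n :> R by rewrite exprn_gt0.
  rewrite [leRHS](_ : _ = 4 * t ^+ 2 / 16 ^+ n + 4 * S * t); last first.
    by field; rewrite gt_eqF.
  apply: ler_wpDl; first by apply: divr_ge0; rewrite ?mulr_ge0 ?sqr_ge0// ltW.
  by apply: ler_peMl; [exact: ltW|lra].
rewrite sqrtrM ?mulr_ge0 ?(ltW t0)// sqrtr_sqr ger0_norm ?invr_ge0 ?exprn_ge0//.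
have -> : Num.sqrt (4 * t) = 2 * Num.sqrt t.
  by rewrite sqrtrM// (_ : 4 = 2 ^+ 2) ?sqrtr_sqr ?ger0_norm//; ring.
rewrite (_ : 4 = 2 * 2); last by ring.
rewrite exprMn natrX exprS le_eqVlt; apply/orP; left; apply/eqP.
by field; rewrite expf_neq0.
Qed.

(** With l = -t/2 and S <= 1 the denominator is at least t/2, so sqrt(t/D) <= 2. *)
Lemma gauss_large (x : 'I_k -> R) : \sum_(i < k) x i ^+ 2 <= 1 ->
  (\int[@tlebesgue R k]_a
     (expR (t / 2 * dotp x a ^+ 2) * expR (- (t * sqnorm a)))%:E <=
   (q * 2)%:E)%E.
Proof.
set S := \sum_(i < k) _ => S1.
under eq_integral => a _.
  rewrite -expRD addrC -[X in t / 2 * X ^+ 2]addr0 -[t / 2 * _]opprK -(mulNr (t / 2)); over.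
have tS : t * S <= t by rewrite ler_piMr// ltW.
have D0 : 0 < t + - (t / 2) * S.
  by rewrite mulNr mulrAC; have := t0; lra.
rewrite integral_gauss_tuple// expr0n/= mulr0 oppr0 expR0 mulr1 lee_fin ler_wpM2l//.
rewrite -[leRHS]ger0_norm// -sqrtr_sqr ler_wsqrtr// ler_pdivrMr//.
by rewrite -/S mulNr (mulrAC t); have := t0; lra.
Qed.

End tuple.
End log_bound.

(** * Uniform bounds on the logarithmic moments *)

Section log_moment.
Variable R : realType.
Local Notation mu := (@lebesgue_measure R).

Lemma measurable_small_sum : measurable_fun [set: R] (@small_sum R).
Proof.
have := @ge0_emeasurable_sum _ R R setT
  (fun n s => (2 ^+ n * expR (- (16 ^+ n * s)))%:E) xpredT.
apply=> [n s _ _|n _]; first by rewrite lee_fin mulr_ge0 ?exprn_ge0 ?expR_ge0.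
apply/measurable_EFinP; apply: measurable_funM => //.
by apply: measurableT_comp => //; apply: measurableT_comp.
Qed.

Lemma measurable_lne_EFin : measurable_fun [set: R] (fun x : R => lne x%:E).
Proof.
rewrite /lne; apply: measurable_fun_ifT => //.
  exact: measurable_fun_ler.
by apply/measurable_EFinP; exact: measurable_ln.
Qed.

Lemma normc_pairing_real k (a : k.-tuple R) (u : k.-tuple R[i]) :
  Normc.normc (pairing (real_tuple a) u) =
  Num.sqrt (dotp (fun i => complex.Re (tnth u i)) a ^+ 2 +
            dotp (fun i => complex.Im (tnth u i)) a ^+ 2).
Proof.
have normcE (z : R[i]) :
  Normc.normc z = Num.sqrt (complex.Re z ^+ 2 + complex.Im z ^+ 2) by case: z.
rewrite normcE; congr (Num.sqrt (_ ^+ 2 + _ ^+ 2)).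
- rewrite (big_morph (@complex.Re R) (id1 := 0) (op1 := +%R))//; last by case=> ? ? [].
  by apply: eq_bigr => i _; rewrite tnth_map; case: (tnth u i) => x y /=; ring.
- rewrite (big_morph (@complex.Im R) (id1 := 0) (op1 := +%R))//; last by case=> ? ? [].
  by apply: eq_bigr => i _; rewrite tnth_map; case: (tnth u i) => x y /=; ring.
Qed.

Lemma cvnorm_Re_Im k (u : k.-tuple R[i]) : cvnorm u ^+ 2 =
  \sum_(i < k) complex.Re (tnth u i) ^+ 2 + \sum_(i < k) complex.Im (tnth u i) ^+ 2.
Proof.
rewrite sqr_sqrtr; last by apply: sumr_ge0 => j _; exact: sqr_ge0.
rewrite -big_split/=; apply: eq_bigr => i _; case: (tnth u i) => x y /=.
by rewrite sqr_sqrtr// addr_ge0 ?sqr_ge0.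
Qed.

(** [X] and [Y] stand for the real and imaginary parts of <a,u>; the symmetry in them is exploited
    below. *)
Definition log_abs (nu X Y : R) : \bar R :=
  (`|lne (Num.sqrt (X ^+ 2 + Y ^+ 2))%:E| `^ nu)%E.

Lemma measurable_log_abs k nu (x y : 'I_k -> R) :
  measurable_fun [set: k.-tuple R] (fun a => log_abs nu (dotp x a) (dotp y a)).
Proof.
apply: (measurableT_comp (measurable_poweR nu)) => //.
apply: measurableT_comp => //; apply: (measurableT_comp measurable_lne_EFin) => //.
under eq_fun => a do rewrite -powR12_sqrt ?addr_ge0 ?sqr_ge0//.
apply: (measurableT_comp (measurable_powR _)) => //.
by apply: measurable_funD; apply: measurable_funX; exact: measurable_dotp.
Qed.

Lemma gauss_log_abs (nu p : R) : 0 < nu -> 0 < p -> p <= 1 ->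
  exists2 K : R, 0 < K & forall k (t : R) (x y : 'I_k -> R), 0 < t ->
  \sum_(i < k) x i ^+ 2 + \sum_(i < k) y i ^+ 2 = 1 ->
  (\int[@tlebesgue R k]_a
     (log_abs nu (dotp x a) (dotp y a) * (expR (- (t * sqnorm a)))%:E) <=
   (Num.sqrt (pi / t) ^+ k * (K * t `^ 2^-1 + 2 * K * t `^ (- p)))%:E)%E.
Proof.
move=> nu0 p0 p1; have [K K0 HK] := lne_powR_bound nu0 p0.
exists (4 * K) => [|k t x y t0 xy1]; first by rewrite mulr_gt0.
(* [gauss_small] needs a vector of squared norm at least 1/2; x and y may be swapped to get it. *)
wlog x2 : x y xy1 / 2^-1 <= \sum_(i < k) x i ^+ 2 => [wlg|].
  have [x2|x2] := leP 2^-1 (\sum_(i < k) x i ^+ 2); first exact: wlg.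
  under eq_integral do rewrite /log_abs addrC -/(log_abs _ _ _).
  by apply: wlg; [rewrite addrC|lra].
have sq0 (z : 'I_k -> R) : 0 <= \sum_(i < k) z i ^+ 2.
  by apply: sumr_ge0 => i _; exact: sqr_ge0.
have x1 : \sum_(i < k) x i ^+ 2 <= 1 by rewrite -xy1 lerDl.
have y1 : \sum_(i < k) y i ^+ 2 <= 1 by rewrite -xy1 lerDr.
pose e (a : k.-tuple R) := expR (- (t * sqnorm a)).
pose G (z : 'I_k -> R) a := (expR (t / 2 * dotp z a ^+ 2) * e a)%:E.
pose S a := (small_sum (dotp x a ^+ 2) * (e a)%:E)%E.
pose c := t `^ (- p) * 2.
have c0 : 0 <= c by rewrite mulr_ge0 ?powR_ge0.
have G0 z a : (0 <= G z a)%E by rewrite lee_fin mulr_ge0 ?expR_ge0.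
have S0 a : (0 <= S a)%E by rewrite mule_ge0 ?small_sum_ge0// lee_fin expR_ge0.
have me : measurable_fun [set: k.-tuple R] e.
  apply: measurableT_comp => //; apply: measurableT_comp => //.
  by apply: measurable_funM => //; exact: measurable_sqnorm.
have mG z : measurable_fun [set: k.-tuple R] (G z).
  apply/measurable_EFinP; apply: measurable_funM => //.
  apply: measurableT_comp => //; apply: measurable_funM => //.
  by apply: measurable_funX; exact: measurable_dotp.
have mS : measurable_fun [set: k.-tuple R] S.
  apply: emeasurable_funM; last exact/measurable_EFinP.
  apply: (measurableT_comp measurable_small_sum).
  by apply: measurable_funX; exact: measurable_dotp.
(* Pointwise domination by [lne_powR_bound] with s = <a,x>^2, followed by [powR_le_gauss]. *)
apply: (@le_trans _ _ (\int[@tlebesgue R k]_a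
    (K%:E * (S a + c%:E * (G x a + G y a)))))%E.
  apply: ge0_le_integralT => a.
    by rewrite mule_ge0 ?poweR_ge0// lee_fin expR_ge0.
  have -> : (K%:E * (S a + c%:E * (G x a + G y a)) =
    K%:E * (small_sum (dotp x a ^+ 2) + (t `^ (- p) *
     (2 * (expR (t / 2 * dotp x a ^+ 2) + expR (t / 2 * dotp y a ^+ 2))))%:E) * (e a)%:E)%E.
    rewrite -muleA; congr (_ * _)%E.
    rewrite ge0_muleDl ?small_sum_ge0//; last first.
      by rewrite lee_fin !mulr_ge0 ?powR_ge0 ?addr_ge0 ?expR_ge0.
    by rewrite /G -EFinD -!EFinM /c; congr (_ + _%:E)%E; ring.
  rewrite lee_wpmul2r ?lee_fin ?expR_ge0// /log_abs.
  have XY0 : 0 <= dotp x a ^+ 2 + dotp y a ^+ 2 by rewrite addr_ge0 ?sqr_ge0.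
  apply: (le_trans (HK _ (dotp x a ^+ 2) (sqrtr_ge0 _) (sqr_ge0 _) _)).
    by rewrite sqr_sqrtr// lerDl sqr_ge0.
  rewrite sqr_sqrtr// lee_wpmul2l ?lee_fin ?(ltW K0)// leeD//.
  by rewrite lee_fin powR_le_gauss.
rewrite ge0_integralZl_EFin//=; last 3 first.
- by move=> a _; rewrite adde_ge0// mule_ge0// adde_ge0.
- apply: emeasurable_funD => //; apply: emeasurable_funM => //.
  exact: emeasurable_funD.
- exact: ltW.
rewrite ge0_integralD//=; last 2 first.
- by move=> a _; rewrite mule_ge0// adde_ge0.
- by apply: emeasurable_funM => //; exact: emeasurable_funD.
rewrite ge0_integralZl_EFin//=; last 2 first.
- by move=> a _; rewrite adde_ge0.
- exact: emeasurable_funD.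
rewrite ge0_integralD//=.
pose q : R := Num.sqrt (pi / t) ^+ k; rewrite -/q.
apply: (@le_trans _ _
   (K%:E * ((q * (4 * t `^ 2^-1))%:E + c%:E * ((q * 2)%:E + (q * 2)%:E)))%E).
  rewrite lee_wpmul2l ?lee_fin ?(ltW K0)// leeD ?gauss_small//.
  by rewrite lee_wpmul2l ?lee_fin// leeD// gauss_large.
by rewrite -EFinD -EFinM lee_fin /c le_eqVlt; apply/orP; left; apply/eqP; ring.
Qed.

Lemma sigma_log_abs (alpha nu : R) : 0 < alpha -> 0 < nu ->
  exists2 C : R, 0 < C & forall k (x y : 'I_k -> R),
  \sum_(i < k) x i ^+ 2 + \sum_(i < k) y i ^+ 2 = 1 ->
  (\int[@sigma R k alpha]_a log_abs nu (dotp x a) (dotp y a) <= C%:E)%E.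
Proof.
(* This [p] lies below both 1, for [powR_le_gauss], and [alpha], for the moment of order -p. *)
move=> a0 nu0; pose p := alpha / (alpha + 1).
have a1 : 0 < alpha + 1 by rewrite addr_gt0.
have p0 : 0 < p by rewrite divr_gt0.
have p1 : p <= 1 by rewrite ler_pdivrMr// mul1r lerDl.
have pa : 0 < alpha + - p.
  by rewrite subr_gt0 ltr_pdivrMr// mulrDr mulr1 ltrDr mulr_gt0.
have ha : 0 < alpha + 2^-1 by rewrite addr_gt0// invr_gt0.
have [K K0 HK] := gauss_log_abs nu0 p0 p1.
exists (K * (Gamma (alpha + 2^-1) / Gamma alpha) +
        2 * K * (Gamma (alpha + - p) / Gamma alpha)) => [|k x y xy1].
  have G0 b : 0 < alpha + b -> 0 < Gamma (alpha + b) / Gamma alpha.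
    by move=> ?; rewrite divr_gt0 ?Gamma_gt0.
  by apply: addr_gt0; apply: mulr_gt0; rewrite ?G0 ?mulr_gt0.
have g0 a : (0 <= log_abs nu (dotp x a) (dotp y a))%E by exact: poweR_ge0.
rewrite ge0_integral_sigma//; last exact: measurable_log_abs.
pose W b t : R := mix_weight k alpha t * Num.sqrt (pi / t) ^+ k * t `^ b.
have W0 b t : (0 <= (W b t)%:E)%E.
  rewrite lee_fin; apply: mulr_ge0 (powR_ge0 _ _); apply: mulr_ge0.
    exact: mix_weight_ge0.
  by rewrite exprn_ge0 ?sqrtr_ge0.
have mW b : measurable_fun [set: R] (fun t => (W b t)%:E).
  apply/measurable_EFinP; apply: measurable_funM; last exact: measurable_powR.
  under eq_fun do rewrite mix_weight_gauss//.
  apply: measurable_funM; first exact: measurable_indic.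
  apply: measurable_funM => //; have := measurable_gamma_fun alpha 1.
  by under eq_fun do rewrite mul1r.
apply: (@le_trans _ _
   (\int[mu]_t (K%:E * (W 2^-1 t)%:E + (2 * K)%:E * (W (- p) t)%:E))%E).
  apply: ge0_le_integralT => t.
    rewrite mule_ge0 ?lee_fin ?mix_weight_ge0//.
    by apply: integral_ge0 => a _; rewrite mule_ge0// lee_fin expR_ge0.
  (* The Gaussian bound requires t > 0; elsewhere the weight annihilates both sides. *)
  have [t0|t0] := leP t 0; first by rewrite /W mix_weight_le0// !mul0r !mule0 mul0e adde0.
  apply: le_trans (lee_wpmul2l _ (HK k t x y t0 xy1)) _.
    by rewrite lee_fin mix_weight_ge0.
  rewrite -!EFinM -EFinD lee_fin /W le_eqVlt; apply/orP; left; apply/eqP; ring.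
have K20 : 0 <= 2 * K by rewrite mulr_ge0// ltW.
rewrite ge0_integralD//=; last 4 first.
- by move=> t _; rewrite mule_ge0// lee_fin ltW.
- by apply: emeasurable_funM => //; exact: mW.
- by move=> t _; apply: mule_ge0 => //; rewrite lee_fin.
- by apply: emeasurable_funM => //; exact: mW.
rewrite !ge0_integralZl_EFin ?(ltW K0)//; [|exact: mW..].
by rewrite /W !integral_mix_powR// -!EFinM -EFinD.
Qed.

End log_moment.

Theorem proposition4p3 (R : realType) (alpha : R) (halpha : 0 < alpha) :
  (forall k : nat, (1 <= k)%N -> sigma alpha [set: k.-tuple R] = 1%E) /\
  (forall nu : R, 1 <= nu ->
   exists C : R, 0 < C /\
   forall (k : nat), (1 <= k)%N ->
   forall u : k.-tuple R[i], cvnorm u = 1 ->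
   (\int[@sigma R k alpha]_a
      `|lne (Normc.normc (pairing (real_tuple a) u))%:E| `^ nu <= C%:E)%E).
Proof.
split=> [k _|nu nu1]; first exact: sigma_setT.
have [C C0 HC] := sigma_log_abs halpha (lt_le_trans ltr01 nu1).
exists C; split=> // k _ u u1.
under eq_integral do rewrite normc_pairing_real.
by apply: HC; rewrite -cvnorm_Re_Im u1 expr1n.
Qed.
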